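(* Let $H$ be a nontrivial graph (that is, a graph with at least two vertices), and let $G=H\circ K_1$ be the corona of $H$. Then $\operatorname{nim}(\mathrm{DNT}(G))=\operatorname{pty}(V(H))$ and $\operatorname{nim}(\mathrm{TER}(G))=1+\operatorname{pty}(V(H))$.
   Context: Graphs are finite and simple with nonempty vertex set. $V(H)$ denotes the vertex set of $H$. The corona $H\circ K_1$ is the graph formed from $H$ by adding, for each $v\in V(H)$, a new vertex $v'$ and a new edge $vv'$. For a graph $G$ with vertex set $V$, a set $K\subseteq V$ is convex if it contains every vertex lying on any shortest path between two elements of $K$. The convex hull $[P]$ of $P\subseteq V$ is the smallest convex set containing $P$. For a finite set $A$, $\operatorname{pty}(A):=|A|\bmod 2\in\{0,1\}$. The game $\mathrm{DNT}(G)$: positions are the sets $P\subseteq V$ with $[V\setminus P]=V$; the starting position is $\emptyset$; the options of $P$ are the sets $P\cup\{v\}$ with $v\in V\setminus P$ and $[V\setminus(P\cup\{v\})]=V$. The game $\mathrm{TER}(G)$: positions are the sets $P\subseteq V$ reachable from the starting position $\emptyset$ by the following moves. If $[V\setminus P]=V$, then the options of $P$ are all sets $P\cup\{v\}$ with $v\in V\setminus P$; if $[V\setminus P]\neq V$, then $P$ is terminal (has no options). The nim-value of a position is defined recursively by $\operatorname{nim}(p)=\operatorname{mex}\{\operatorname{nim}(q): q\text{ an option of }p\}$, where $\operatorname{mex}(A)$ is the smallest nonnegative integer not in $A$; the nim-value of a game is that of its starting position.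
   Formalization: The formal theorem also assumes that H has no isolated vertex (automatic if H is connected with at least two vertices); without this the claim fails, e.g. for H the disjoint union of K_2 and K_1, where nim(DNT(G)) = 0 but pty(V(H)) = 1. *)

(* Defs.v *)
From mathcomp Require Import all_boot.

Set Implicit Arguments.
Unset Strict Implicit.
Unset Printing Implicit Defensive.

Record graph := Graph {
  vertex :> finType;
  adj : rel vertex;
  adj_sym : symmetric adj;
  adj_irr : irreflexive adj;
  vertex_gt0 : 0 < #|vertex| }.

Definition nontrivial (G : graph) : bool := 1 < #|G|.

(* Graphs may be disconnected. An isolated vertex v of H yields in the corona a
   component {v, v'} whose two vertices are both leaves; the corona formulas
   then fail, e.g. for the disjoint union of K_2 and K_1. Connected nontrivial
   graphs have no isolated vertex. *)
Definition no_isolated_vertex (G : graph) : Prop :=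
  forall x : G, exists y : G, adj x y.

(* Corona: inl v is the vertex v of H, inr v is the new leaf v'. *)

Section Corona.
Variable H : graph.

Definition corona_adj : rel (H + H)%type := fun x y =>
  match x, y with
  | inl u, inl v => adj u v
  | inl u, inr v | inr u, inl v => u == v
  | inr _, inr _ => false
  end.

Fact corona_adj_sym : symmetric corona_adj.
Proof. by move=> [u|u] [v|v] //=; rewrite adj_sym. Qed.

Fact corona_adj_irr : irreflexive corona_adj.
Proof. by move=> [u|u] //=; rewrite adj_irr. Qed.

Fact corona_vertex_gt0 : 0 < #|{: H + H}|.
Proof. by rewrite card_sum addn_gt0 vertex_gt0. Qed.

Definition corona : graph :=
  Graph corona_adj_sym corona_adj_irr corona_vertex_gt0.

End Corona.

Section Convexity.
Variable G : graph.

Implicit Types P K : {set G}.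

(* x :: p is a walk from x to y and no walk from x to y is shorter. A shortest
   walk repeats no vertex, so these are exactly the shortest paths. *)
Definition shortest_path (x y : G) (p : seq G) : bool :=
  [&& path (@adj G) x p, last x p == y
    & [forall n : 'I_(size p), forall q : n.-tuple G,
         ~~ (path (@adj G) x q && (last x q == y))]].

(* The bound on the length only serves decidability: see on_shortest_pathP. *)
Definition on_shortest_path (x y z : G) : bool :=
  [exists n : 'I_#|G|, exists p : n.-tuple G,
     shortest_path x y p && (z \in x :: p)].

Lemma shortest_pathP x y p :
  reflect [/\ path (@adj G) x p, last x p = y
            & forall q, path (@adj G) x q -> last x q = y -> size p <= size q]
          (shortest_path x y p).
Proof.
apply: (iffP and3P) => [[xp /eqP lp /forallP min] | [xp lp min]].
  split=> // q xq lq; rewrite leqNgt; apply/negP => lt_qp.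
  have /forallP/(_ (in_tuple q)) := min (Ordinal lt_qp).
  by rewrite /= xq lq eqxx.
split=> //; first exact/eqP.
apply/forallP => n; apply/forallP => q; apply/negP => /andP[xq /eqP lq].
by have := min q xq lq; rewrite size_tuple leqNgt ltn_ord.
Qed.

Lemma shortest_path_uniq x y p : shortest_path x y p -> uniq (x :: p).
Proof.
case/shortest_pathP=> xp lp min; case/shortenP: xp lp min => q xq uq sub lq min.
apply: (leq_size_uniq uq); last by rewrite /= ltnS (min q).
by move=> z; rewrite !inE => /orP[-> // | /sub ->]; rewrite orbT.
Qed.

Lemma on_shortest_pathP x y z :
  reflect (exists2 p, shortest_path x y p & z \in x :: p)
          (on_shortest_path x y z).
Proof.
apply: (iffP existsP) => [[n /existsP[p /andP[sp zp]]] | [p sp zp]].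
  by exists p.
have lt_p : size p < #|G|.
  by rewrite -[_.+1]/(size (x :: p)) -(card_uniqP (shortest_path_uniq sp)) max_card.
exists (Ordinal lt_p); apply/existsP; exists (in_tuple p).
exact/andP.
Qed.

Definition convex (K : {set G}) : bool :=
  [forall x in K, forall y in K, forall z, on_shortest_path x y z ==> (z \in K)].

Definition hull (P : {set G}) : {set G} :=
  \bigcap_(K : {set G} | convex K && (P \subset K)) K.

Definition generating (P : {set G}) : bool := hull P == [set: G].

Lemma hull_convex P : convex (hull P).
Proof.
apply/forall_inP => x /bigcapP xP; apply/forall_inP => y /bigcapP yP.
apply/forallP => z; apply/implyP => xyz; apply/bigcapP => K KP.
have /andP[/forall_inP/(_ x (xP K KP))/forall_inP/(_ y (yP K KP)) cK _] := KP.
by move/forallP/(_ z)/implyP: cK; apply.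
Qed.

Lemma sub_hull P : P \subset hull P.
Proof. by apply/bigcapsP => K /andP[]. Qed.

Lemma hull_min P K : convex K -> P \subset K -> hull P \subset K.
Proof. by move=> cK sPK; apply: bigcap_inf; rewrite cK. Qed.

End Convexity.

Fact mex_subproof (s : seq nat) : exists n, n \notin s.
Proof.
exists (sumn s).+1; apply/negP => /(nthP 0)[i lt_i eq_i].
have : nth 0 s i <= sumn s.
  elim: s i lt_i {eq_i} => //= a s IH [|i] lt_i; first exact: leq_addr.
  exact: leq_trans (IH i lt_i) (leq_addl _ _).
by rewrite eq_i ltnn.
Qed.

Definition mex (s : seq nat) : nat := ex_minn (mex_subproof s).

(* A finite impartial game; the rank only witnesses termination. Elements of
   position need not be reachable from start; such elements do not affect the
   nim-value of start. *)
Record game := Game {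
  position : finType;
  start : position;
  options : position -> {set position};
  rank : position -> nat;
  rank_lt : forall p q, q \in options p -> rank q < rank p }.

Section Nim.
Variable g : game.

(* n is fuel; nimE is the recursive equation defining nim-values. *)
Fixpoint nim_fuel (n : nat) (p : position g) : nat :=
  if n is n'.+1 then mex [seq nim_fuel n' q | q <- enum (options p)] else 0.

Definition nim_position (p : position g) : nat := nim_fuel (rank p).+1 p.

Lemma nim_fuelE n m p :
  rank p < n -> rank p < m -> nim_fuel n p = nim_fuel m p.
Proof.
elim: n m p => [|n IH] [|m] p //=; rewrite !ltnS => le_n le_m.
congr mex; apply/eq_in_map => q; rewrite mem_enum => /rank_lt lt_q.
by apply: IH; apply: leq_trans lt_q _.
Qed.

Lemma nimE p :
  nim_position p = mex [seq nim_position q | q <- enum (options p)].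
Proof.
rewrite {1}/nim_position /=; congr mex; apply/eq_in_map => q.
by rewrite mem_enum => /rank_lt lt_q; apply: nim_fuelE.
Qed.

Definition nim : nat := nim_position (start g).

End Nim.

Section Games.
Variable G : graph.
Implicit Types P Q : {set G}.

Definition DNT_options P : {set {set G}} :=
  [set v |: P | v in ~: P & generating (~: (v |: P))].

Definition TER_options P : {set {set G}} :=
  if generating (~: P) then [set v |: P | v in ~: P] else set0.

Fact card_setC_lt P v : v \in ~: P -> #|~: (v |: P)| < #|~: P|.
Proof.
by move=> vP; rewrite [ltnRHS](cardsD1 v) vP setCU setIC -setDE.
Qed.

Fact DNT_rank P Q : Q \in DNT_options P -> #|~: Q| < #|~: P|.
Proof.
by case/imsetP=> v; rewrite !inE => /andP[vP _] ->; apply: card_setC_lt; rewrite inE.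
Qed.

Fact TER_rank P Q : Q \in TER_options P -> #|~: Q| < #|~: P|.
Proof.
rewrite /TER_options; case: ifP => _; last by rewrite inE.
by case/imsetP=> v vP ->; apply: card_setC_lt.
Qed.

Definition DNT : game := @Game {set G} set0 DNT_options _ DNT_rank.
Definition TER : game := @Game {set G} set0 TER_options _ TER_rank.

End Games.

Definition pty (T : finType) (A : {set T}) : nat := #|A| %% 2.

(* Main.v *)
Require Import Defs.
From mathcomp Require Import all_boot.

Set Implicit Arguments.
Unset Strict Implicit.
Unset Printing Implicit Defensive.

(** Let L be the set of leaves of the corona. A leaf lies on a shortest path only
    as an end, so a generating set contains L; conversely, if uv is an edge of H
    then u', u, v, v' is a shortest path, so L is generating because every vertex
    of H has a neighbour. Hence both games only depend on the number k of vertices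
    of H not yet chosen, as long as no leaf is chosen: in DNT exactly k moves
    remain, while in TER choosing a leaf ends the game with nim-value 0, so that
    the value is mex {0} = 1 if k = 0, and then alternates between
    mex {0, 1} = 2 and mex {0, 2} = 1. *)

Lemma mex_unique (s : seq nat) n :
  n \notin s -> (forall m, m < n -> m \in s) -> mex s = n.
Proof.
move=> ns lt_s; rewrite /mex; case: ex_minnP => m ms min_m.
apply/eqP; rewrite eqn_leq (min_m n ns) leqNgt /=.
by apply/negP => /lt_s; apply/negP.
Qed.

(** Shape of the option values in [DNT] with [k] moves left: there is no option when [k] is 0, and
    otherwise all options share one value in {0, 1}, which the mex flips. *)
Lemma mex_constant_parity (s : seq nat) k :
  (forall m, m \in s = (0 < k) && (m == k.-1 %% 2)) -> mex s = k %% 2.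
Proof.
case: k => [|k] sE; rewrite modn2; apply: mex_unique => [|m].
- by rewrite sE.
- by case: m => // _; rewrite sE.
- by rewrite sE modn2 /=; case: odd.
- by rewrite sE modn2 /=; case: m => [|[|[]]]; case: odd.
Qed.

(** Shape of the option values in [TER]: 0 comes from the moves that end the game, the other value
    from moves that leave [k.-1] safe vertices. *)
Lemma mex_zero_parity (s : seq nat) k :
  (forall m, m \in s = (m == 0) || (0 < k) && (m == 1 + k.-1 %% 2)) ->
  mex s = 1 + k %% 2.
Proof.
case: k => [|k] sE; rewrite modn2; apply: mex_unique => [|m].
- by rewrite sE.
- by case: m => // _; rewrite sE.
- by rewrite sE modn2 /=; case: odd.
- by rewrite sE modn2 /=; case: m => [|[|[]]]; case: odd.
Qed.

Section Leaf.
Variables (G : graph) (x : G).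
Hypothesis x_leaf : forall y z, adj x y -> adj x z -> y = z.

(** An interior vertex of a shortest path has two distinct neighbours on it, because such a path
    repeats no vertex; a leaf has at most one neighbour. *)
Lemma leaf_setC1_convex : convex (~: [set x]).
Proof.
apply/forall_inP => a; rewrite !inE => ax; apply/forall_inP => b; rewrite !inE => bx.
apply/forallP => z; apply/implyP => /on_shortest_pathP[p sp zp]; rewrite !inE.
apply: contraNneq ax => zx; move: zp; rewrite {z}zx inE eq_sym => /orP[// | xp].
case/splitPr: xp sp => p1 p2 sp; have /shortest_pathP[+ + _] := sp.
rewrite cat_path last_cat /= => /and3P[_ lx]; have := shortest_path_uniq sp.
(* If nothing follows [x], then [x] is the endpoint [b], which is excluded. Otherwise its successor
   [y] and its predecessor [last a p1] coincide, against uniqueness. *)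
case: p2 {sp} => [|y p2]; first by move=> _ _ /= eb; rewrite -eb eqxx in bx.
rewrite -cat_cons cat_uniq => /and3P[_ /hasPn/(_ (last a p1)) + _] /= /andP[xy _] _.
have -> : y = last a p1 by apply: x_leaf; rewrite // adj_sym.
by rewrite mem_last !inE eqxx orbT => /(_ isT).
Qed.

Lemma leaf_generating P : generating P -> x \in P.
Proof.
move/eqP=> hP; apply/negPn/negP => xP.
have /(hull_min leaf_setC1_convex)/subsetP/(_ x) : P \subset ~: [set x].
  by apply/subsetP => y yP; rewrite !inE; apply: contraNneq xP => <-.
by rewrite hP !inE eqxx => /(_ isT).
Qed.

End Leaf.

Section CoronaConvexity.
Variable H : graph.
Hypothesis H_no_isolated : no_isolated_vertex H.

Definition leaves : {set corona H} := [set inr v | v : H].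

Lemma inr_leaves v : (inr v \in leaves).
Proof. exact: imset_f. Qed.

Lemma inl_leaves v : (inl v \in leaves) = false.
Proof. by apply/imsetP => -[]. Qed.

(** The only neighbours of the two ends are [inl u] and [inl v], which differ, so a walk between the
    ends has at least three edges. *)
Lemma corona_shortest_path (u v : H) : adj u v ->
  @shortest_path (corona H) (inr u) (inr v) [:: inl u; inl v; inr v].
Proof.
move=> uv; have nuv : u != v by apply: contraTneq uv => ->; rewrite adj_irr.
apply/shortest_pathP; split=> //=; first by rewrite !eqxx uv.
case=> [_ /= [euv] | a [|b [|]] //=]; first by rewrite euv eqxx in nuv.
  by move=> + ea; rewrite ea.
case: a => //= a /and3P[/eqP <- + _] eb.
by rewrite eb /= (negPf nuv).
Qed.

Lemma corona_generatingE (P : {set corona H}) : generating P = (leaves \subset P).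
Proof.
apply/idP/idP => [gP | sLP].
  apply/subsetP => _ /imsetP[v _ ->]; apply: leaf_generating gP.
  by move=> [y|y] [z|z] //= /eqP <- /eqP <-.
have in_hull v : inr v \in hull P by apply/(subsetP (sub_hull P))/(subsetP sLP)/inr_leaves.
rewrite /generating eqEsubset subsetT; apply/subsetP => -[u|u] _ //.
have [v uv] := H_no_isolated u.
have /forall_inP/(_ _ (in_hull u)) := hull_convex P.
move=> /forall_inP/(_ _ (in_hull v))/forallP/(_ (inl u))/implyP; apply.
apply/on_shortest_pathP; exists [:: inl u; inl v; inr v].
  exact: corona_shortest_path.
by rewrite !inE eqxx.
Qed.

End CoronaConvexity.

Section GamesWithLeastGeneratingSet.
Variables (G : graph) (L : {set G}).
Hypothesis generatingE : forall P : {set G}, generating P = (L \subset P).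

Let generatingC P : generating (~: P) = [disjoint P & L].
Proof. by rewrite generatingE -disjoints_subset disjoint_sym. Qed.

Let disjointU1 v (P : {set G}) : [disjoint v |: P & L] = (v \notin L) && [disjoint P & L].
Proof. by rewrite -!setI_eq0 setIUl setU_eq0 !setI_eq0 disjoints1. Qed.

(** The vertices that can still be chosen without touching [L]. From here on, the corona enters only
    through its least generating set [L]. *)
Let free (P : {set G}) : nat := #|~: L :\: P|.

Let freeU1 v (P : {set G}) : v \notin P -> v \notin L -> free (v |: P) = (free P).-1.
Proof.
move=> vP vL; rewrite /free (cardsD1 v (~: L :\: P)) !inE vP vL /=.
by rewrite setDDl setUC.
Qed.

Lemma DNT_nim_position (P : {set G}) :
  [disjoint P & L] -> nim_position (g := DNT G) P = free P %% 2.
Proof.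
have [n] := ubnP (free P); elim: n P => // n IH P; rewrite ltnS => le_n dP.
have step v : v \notin P -> v \notin L ->
    nim_position (g := DNT G) (v |: P) = (free P).-1 %% 2 /\ 0 < free P.
  move=> vP vL; have fP : 0 < free P by apply/card_gt0P; exists v; rewrite !inE vP.
  by rewrite -(freeU1 vP) // IH ?disjointU1 ?vL // freeU1 // prednK.
rewrite nimE; apply: mex_constant_parity => m; apply/mapP/andP.
  case=> Q; rewrite mem_enum => /imsetP[v]; rewrite !inE generatingC disjointU1.
  by case/andP=> vP /andP[vL _] -> ->; have [-> ->] := step v vP vL.
case=> /card_gt0P[v]; rewrite !inE => /andP[vP vL] /eqP ->.
exists (v |: P); last by have [-> _] := step v vP vL.
by rewrite mem_enum; apply: imset_f; rewrite !inE vP generatingC disjointU1 vL.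
Qed.

Lemma DNT_nim : nim (DNT G) = pty (~: L).
Proof. by rewrite /nim DNT_nim_position /free ?setD0 // -setI_eq0 set0I. Qed.

Lemma TER_nim_terminal (P : {set G}) :
  ~~ [disjoint P & L] -> nim_position (g := TER G) P = 0.
Proof.
move=> dP; rewrite nimE /= /TER_options generatingC (negPf dP) enum_set0.
exact: mex_unique.
Qed.

Hypothesis L_neq0 : L != set0.

Lemma TER_nim_position (P : {set G}) :
  [disjoint P & L] -> nim_position (g := TER G) P = 1 + free P %% 2.
Proof.
have [n] := ubnP (free P); elim: n P => // n IH P; rewrite ltnS => le_n dP.
have step v : v \notin P -> v \notin L ->
    nim_position (g := TER G) (v |: P) = 1 + (free P).-1 %% 2 /\ 0 < free P.
  move=> vP vL; have fP : 0 < free P by apply/card_gt0P; exists v; rewrite !inE vP.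
  by rewrite -(freeU1 vP) // IH ?disjointU1 ?vL // freeU1 // prednK.
have leaf_step v : v \in L -> nim_position (g := TER G) (v |: P) = 0.
  by move=> vL; rewrite TER_nim_terminal // disjointU1 vL.
rewrite nimE /= /TER_options generatingC dP.
apply: mex_zero_parity => m; apply/mapP/orP.
  case=> Q; rewrite mem_enum => /imsetP[v]; rewrite !inE => vP -> ->.
  have [vL|vL] := boolP (v \in L); first by left; rewrite leaf_step.
  by right; have [-> ->] := step v vP vL; rewrite eqxx.
case=> [/eqP -> | /andP[/card_gt0P[v]]].
  (* As [P] misses [L], any element of [L] is still available, and choosing it is the move of value
     0. *)
  have /set0Pn[v vL] := L_neq0; exists (v |: P); last by rewrite leaf_step.
  by rewrite mem_enum; apply: imset_f; rewrite inE (disjointFl dP).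
rewrite !inE => /andP[vP vL] /eqP ->.
exists (v |: P); last by have [-> _] := step v vP vL.
by rewrite mem_enum; apply: imset_f; rewrite inE.
Qed.

Lemma TER_nim : nim (TER G) = 1 + pty (~: L).
Proof. by rewrite /nim TER_nim_position /free ?setD0 // -setI_eq0 set0I. Qed.

End GamesWithLeastGeneratingSet.

(** The non-leaves are exactly the copy of [H] embedded by [inl]. *)
Lemma pty_setC_leaves (H : graph) : pty (~: leaves H) = pty [set: H].
Proof.
rewrite /pty -(card_imset [set: H] (@inl_inj H H)).
congr (#|pred_of_set _| %% 2); apply/setP => -[v|v]; rewrite inE.
  by rewrite inl_leaves imset_f.
by rewrite inr_leaves; apply/esym/imsetP => -[].
Qed.

Theorem proposition4p8 (H : graph) (H_nontrivial : nontrivial H)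
    (H_no_isolated : no_isolated_vertex H) :
  nim (DNT (corona H)) = pty [set: H] /\
  nim (TER (corona H)) = 1 + pty [set: H].
Proof.
have genE := @corona_generatingE H H_no_isolated.
rewrite -pty_setC_leaves (DNT_nim genE) (TER_nim genE) //.
(* What remains is that [leaves H] is nonempty: any vertex of [H] carries a leaf. *)
have /card_gt0P[v _] := vertex_gt0 H.
by apply/set0Pn; exists (inr v); apply: inr_leaves.
Qed.
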